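(* Let $B$ be a finite non-empty set of equivalence relations and let $C=\mathrm{Av}(B)$ under the consecutive embedding order. Then $C$ is well quasi-ordered under the consecutive embedding order if and only if the factor graph $\Gamma_B$ has no in-out cycles and no special vertices in cycles.
   Context: Equivalence relations and order. An equivalence relation here is a pair $(X,\rho)$ with $X$ a finite non-empty subset of $\mathbb{N}$ (with its natural linear order) and $\rho$ an equivalence relation on $X$; its length is $|\rho|=|X|$. For $X=\{x_1<\dots<x_n\}$ and $Y=\{y_1<\dots<y_m\}$, a map $f:X\to Y$ is contiguous if there is $k$ with $f(x_i)=y_{k+i-1}$ for all $i\in\{1,\dots,n\}$. The consecutive embedding order: $(X,\rho)\le(Y,\sigma)$ iff there is a contiguous map $f:X\to Y$ such that $(x,y)\in\rho\Leftrightarrow(f(x),f(y))\in\sigma$ for all $x,y\in X$. Write $\rho\cong\sigma$ (isomorphic) if such an $f$ exists which is a bijection. Isomorphic relations are considered equal (so one may take the underlying set to be $[1,n]=\{1,\dots,n\}$), and this gives a poset. $\mathrm{Av}(B)$ is the set of equivalence relations $\sigma$ with $\rho\not\le\sigma$ for all $\rho\in B$. A poset is well quasi-ordered (wqo) if it has no infinite antichains and no infinite descending chains. Factor graph. Let $b=\max\{|\rho|:\rho\in B\}$. For a subset $S$ of the underlying set, $\rho{\upharpoonright}_S$ denotes the restriction of $\rho$ to $S$. The factor graph $\Gamma_B$ is the digraph whose vertices are the equivalence relations on $[1,b]$ that belong to $C$, with an edge from $\mu$ to $\nu$ (loops allowed) iff $\mu{\upharpoonright}_{[2,b]}\cong\nu{\upharpoonright}_{[1,b-1]}$.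 A vertex of $\Gamma_B$ is special if the equivalence class of its largest entry $b$ has size one. Digraph terms. A path is a sequence of vertices $v_1\to\dots\to v_n$ with each $(v_i,v_{i+1})$ an edge; its length is $n-1$. A cycle is a path of length at least one with $v_1=v_n$ (vertices may otherwise repeat). The in-degree (out-degree) of $v$ is the number of vertices $u$ such that $(u,v)$ (respectively $(v,u)$) is an edge. An in-out cycle is a cycle containing at least one vertex of in-degree two or more and at least one vertex of out-degree two or more. *)

(* Defs.v *)
From mathcomp Require Import all_boot finmap.

Set Implicit Arguments.
Unset Strict Implicit.
Unset Printing Implicit Defensive.

Local Open Scope fset_scope.
Local Open Scope nat_scope.

(* A pair (X, rho): a finite subset of nat together with a set of pairs.  Only
   the pairs satisfying [is_equivalence] are equivalence relations in the intended sense;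
   restrictions, whose carrier may be empty, are taken in the ambient type. *)
Definition relstr : Type := ({fset nat} * {fset nat * nat})%type.

Definition carrier (r : relstr) : {fset nat} := r.1.

Definition related (r : relstr) (x y : nat) : bool := (x, y) \in r.2.

Definition len (r : relstr) : nat := #|` carrier r|.

Definition is_equivalence (r : relstr) : bool :=
  [&& carrier r != fset0,
      r.2 `<=` carrier r `*` carrier r,
      [forall x : carrier r, related r (val x) (val x)],
      [forall x : carrier r, forall y : carrier r,
         related r (val x) (val y) ==> related r (val y) (val x)]
    & [forall x : carrier r, forall y : carrier r, forall z : carrier r,
         related r (val x) (val y) && related r (val y) (val z)
           ==> related r (val x) (val z)]].

(* For X = {x_0 < ... < x_(n-1)}, [pos X x_i = i]. *)
Definition pos (X : {fset nat}) (x : nat) : nat := index x (sort leq X).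

(* f x_i = y_(k+i) for all i; the offset k is counted from 0.  It is at most
   #|` Y| as soon as X is nonempty, and irrelevant when X is empty. *)
Definition contiguous (X Y : {fset nat}) (f : {ffun X -> Y}) : bool :=
  [exists k : 'I_(#|` Y|.+1),
    [forall x : X, pos Y (val (f x)) == k + pos X (val x)]].

Definition embedding (r s : relstr) (f : {ffun carrier r -> carrier s}) : bool :=
  contiguous f &&
  [forall x : carrier r, forall y : carrier r,
     related r (val x) (val y) == related s (val (f x)) (val (f y))].

Definition embeds (r s : relstr) : bool :=
  [exists f : {ffun carrier r -> carrier s}, embedding f].

Definition isomorphic (r s : relstr) : bool :=
  [exists f : {ffun carrier r -> carrier s},
    [&& embedding f, injectiveb f
      & [forall y : carrier s, exists x : carrier r, f x == y]]].

Definition Av (B : {fset relstr}) (s : relstr) : bool :=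
  is_equivalence s && [forall r : B, ~~ embeds (val r) s].

(* Well quasi-ordering of the subset P of T.  No equality on T is used: on
   equivalence relations, isomorphic elements are identified, and they are
   exactly those lying below one another. *)
Definition wqo (T : Type) (le : rel T) (P : pred T) : Prop :=
  ~ (exists a : nat -> T,
       (forall i, P (a i)) /\ (forall i j, i != j -> ~~ le (a i) (a j)))
  /\
  ~ (exists d : nat -> T,
       (forall i, P (d i)) /\
       (forall i, le (d i.+1) (d i) && ~~ le (d i) (d i.+1))).

Definition interval (m n : nat) : {fset nat} := [fset x in index_iota m n.+1].

Definition restrict (r : relstr) (S : {fset nat}) : relstr :=
  (carrier r `&` S, r.2 `&` (S `*` S)).

Section FactorGraph.
Variable B : {fset relstr}.

Definition maxlen : nat := \max_(r <- B) len r.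

Definition vertices : {fset relstr} :=
  [fset r in [fset (interval 1 maxlen, g)
               | g in fpowerset (interval 1 maxlen `*` interval 1 maxlen)]
   | Av B r].

Definition edge (mu nu : relstr) : bool :=
  [&& mu \in vertices, nu \in vertices
    & isomorphic (restrict mu (interval 2 maxlen))
                 (restrict nu (interval 1 maxlen.-1))].

Definition indegree (v : relstr) : nat :=
  #|` [fset u in vertices | edge u v]|.

Definition outdegree (v : relstr) : nat :=
  #|` [fset u in vertices | edge v u]|.

Definition special (v : relstr) : bool :=
  #|` [fset y in carrier v | related v maxlen y]| == 1.

(* The closed path v_1 -> ... -> v_n = v_1 is represented by the sequence
   v_1, ..., v_(n-1), without the final repetition of v_1. *)
Definition graph_cycle (c : seq relstr) : bool := (c != [::]) && cycle edge c.

Definition in_out_cycle (c : seq relstr) : bool :=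
  [&& graph_cycle c, has (fun v => 2 <= indegree v) c
    & has (fun v => 2 <= outdegree v) c].

End FactorGraph.

(* Main.v *)
(* Sliding a window of size b over a relation in Av(B) gives a walk in the
   factor graph, and every walk arises this way: label the entries from left to
   right, copying the label of a related entry of the window or, at a special
   vertex, taking a fresh one.

   From an in-out cycle one gets a simple cycle Z with an edge a -> x entering
   it and an edge y -> d leaving it, neither in Z.  The walks a, x, ..., y, d
   winding n times around Z are pairwise incomparable.  From a special vertex v
   on a cycle, take a long walk from v to v and give the entry created at its
   end the label created at its start.  In such a relation the only related pair
   of entries created at occurrences of v is the pair of its two ends, so
   relations of this kind with different lengths are incomparable.

   Conversely, without these configurations every cycle has all in-degrees one
   or all out-degrees one, and no class is born or dies along it.  Hence a cycle
   of the first kind determines everything to the left of a window lying on it,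
   and a cycle of the second kind everything to the right.  A relation is thus
   given by a core of bounded length together with the lengths of its left and
   right extensions, and Dickson's lemma applies. *)
Require Import Defs.
From Stdlib Require Import Classical IndefiniteDescription.
From mathcomp Require Import all_boot finmap zify.

Set Implicit Arguments.
Unset Strict Implicit.
Unset Printing Implicit Defensive.

Local Open Scope fset_scope.
Local Open Scope nat_scope.

(** * Relations read through the ranks of their entries *)

Definition ix (r : relstr) (i j : nat) : bool :=
  related r (nth 0 (sort leq (carrier r)) i) (nth 0 (sort leq (carrier r)) j).

Lemma size_sort_fset (X : {fset nat}) : size (sort leq X) = #|` X|.
Proof. by rewrite size_sort. Qed.

Lemma nth_sort_in (X : {fset nat}) i : i < #|` X| -> nth 0 (sort leq X) i \in X.
Proof.
by move=> lt_i; rewrite -(mem_sort leq) mem_nth ?size_sort_fset.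
Qed.

Lemma pos_lt (X : {fset nat}) x : x \in X -> pos X x < #|` X|.
Proof. by rewrite /pos -size_sort_fset index_mem mem_sort. Qed.

Lemma nth_pos (X : {fset nat}) x : x \in X -> nth 0 (sort leq X) (pos X x) = x.
Proof. by move=> Xx; rewrite /pos nth_index ?mem_sort. Qed.

Lemma pos_nth (X : {fset nat}) i :
  i < #|` X| -> pos X (nth 0 (sort leq X) i) = i.
Proof.
by move=> lt_i; rewrite /pos index_uniq ?size_sort_fset ?sort_uniq ?fset_uniq.
Qed.

Lemma ix_pos r x y : x \in carrier r -> y \in carrier r ->
  ix r (pos (carrier r) x) (pos (carrier r) y) = related r x y.
Proof. by move=> rx ry; rewrite /ix !nth_pos. Qed.

Lemma embedding_offset r s (f : {ffun carrier r -> carrier s}) :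
  embedding f -> exists k, [/\ k + len r <= len s,
    forall i j, i < len r -> j < len r -> ix r i j = ix s (k + i) (k + j)
  & forall x, pos (carrier s) (val (f x)) = k + pos (carrier r) (val x)].
Proof.
case/andP=> /existsP[k /forallP fk] /forallP fE.
have fkE x : pos (carrier s) (val (f x)) = k + pos (carrier r) (val x).
  exact/eqP.
have entE i (lt_i : i < len r) :
    val (f [` nth_sort_in lt_i]) = nth 0 (sort leq (carrier s)) (k + i).
  have := fkE [` nth_sort_in lt_i]; rewrite /= pos_nth // => <-.
  by rewrite nth_pos // (valP (f _)).
exists k; split=> //; last first.
  move=> i j lt_i lt_j.
  have /forallP/(_ [` nth_sort_in lt_j])/eqP := fE [` nth_sort_in lt_i].
  by rewrite /ix !entE.
(* The image of the last entry bounds the offset; for an empty [r] the bound comes from the ordinal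
   type of [k]. *)
have [->|r_gt0] := posnP (len r).
  by rewrite addn0 -ltnS ltn_ord.
have lt_last : (len r).-1 < len r by rewrite prednK.
have := pos_lt (valP (f [` nth_sort_in lt_last])).
by rewrite fkE /= pos_nth // -/(len s); lia.
Qed.

Lemma offset_embedding r s k : k + len r <= len s ->
  (forall i j, i < len r -> j < len r -> ix r i j = ix s (k + i) (k + j)) ->
  exists2 f : {ffun carrier r -> carrier s}, embedding f &
    forall x, pos (carrier s) (val (f x)) = k + pos (carrier r) (val x).
Proof.
move=> le_k rsE.
have lt_f (x : carrier r) : k + pos (carrier r) (val x) < len s.
  by have := pos_lt (valP x); rewrite -/(len r); lia.
pose f : {ffun carrier r -> carrier s} := [ffun x => [` nth_sort_in (lt_f x)]].
have fE x : pos (carrier s) (val (f x)) = k + pos (carrier r) (val x).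
  by rewrite ffunE /= pos_nth ?lt_f.
exists f => //; apply/andP; split.
  have lt_k : k < (len s).+1 by lia.
  by apply/existsP; exists (Ordinal lt_k); apply/forallP => x; rewrite fE.
apply/forallP => x; apply/forallP => y; apply/eqP.
rewrite -[LHS]ix_pos ?(valP x) ?(valP y) // rsE ?pos_lt ?(valP x) ?(valP y) //.
by rewrite -!fE ix_pos ?(valP (f _)).
Qed.

Lemma embedsP r s : reflect (exists2 k, k + len r <= len s &
    forall i j, i < len r -> j < len r -> ix r i j = ix s (k + i) (k + j))
  (embeds r s).
Proof.
apply: (iffP existsP) => [[f /embedding_offset[k [le_k rsE _]]]|[k le_k rsE]].
  by exists k.
by have [f] := offset_embedding le_k rsE; exists f.
Qed.

Lemma isomorphicP r s : reflect (len r = len s /\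
    forall i j, i < len r -> j < len r -> ix r i j = ix s i j)
  (isomorphic r s).
Proof.
apply: (iffP existsP) => [[f /and3P[emb_f _ /forallP f_surj]]|[eq_len rsE]].
  have [k [le_k rsE fE]] := embedding_offset emb_f.
  have [s0|s_gt0] := posnP (len s).
    have r0 : len r = 0 by lia.
    by split=> [|i j]; rewrite r0.
  have lt_last : (len s).-1 < len s by rewrite prednK.
  (* A preimage of the first entry of [s] forces offset zero, and a preimage of its last entry
     forces equal lengths. *)
  have /existsP[x /eqP fx] := f_surj [` nth_sort_in s_gt0].
  have := fE x; rewrite fx /= pos_nth // => k0.
  have /existsP[y /eqP fy] := f_surj [` nth_sort_in lt_last].
  have := fE y; rewrite fy /= pos_nth // => lastE.
  have /= := pos_lt (valP y); rewrite -/(len r) => lt_y.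
  have {}k0 : k = 0 by lia.
  by split=> [|i j lt_i lt_j]; [lia | rewrite rsE ?k0].
have [||f emb_f fE] := @offset_embedding r s 0; [by rewrite eq_len | by [] |].
have posK (t : relstr) (x y : carrier t) :
    pos (carrier t) (val x) = pos (carrier t) (val y) -> x = y.
  move=> eq_xy; apply: val_inj.
  by rewrite -(nth_pos (valP x)) eq_xy nth_pos ?(valP y).
exists f; apply/and3P; split=> //.
  apply/injectiveP => x y eq_f; apply: posK.
  by apply/eqP; rewrite -(eqn_add2l 0) -!fE eq_f.
apply/forallP => y; apply/existsP.
have lt_y : pos (carrier s) (val y) < len r.
  by rewrite eq_len pos_lt ?(valP y).
exists [` nth_sort_in lt_y]; apply/eqP/posK.
by rewrite fE /= pos_nth.
Qed.

Lemma embeds_trans r s t : embeds r s -> embeds s t -> embeds r t.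
Proof.
case/embedsP=> k le_k rsE /embedsP[l le_l stE].
apply/embedsP; exists (l + k); first lia.
by move=> i j lt_i lt_j; rewrite rsE // stE ?addnA //; lia.
Qed.

Lemma is_equivalenceP r : reflect
  [/\ 0 < len r, r.2 `<=` carrier r `*` carrier r,
    forall i, i < len r -> ix r i i,
    forall i j, i < len r -> j < len r -> ix r i j -> ix r j i
  & forall i j k, i < len r -> j < len r -> k < len r ->
      ix r i j -> ix r j k -> ix r i k]
  (is_equivalence r).
Proof.
rewrite /is_equivalence -cardfs_gt0.
apply: (iffP and5P) => [[r0 sub /forallP rr /forallP rs /forallP rt]|].
  split=> // [i lt_i|i j lt_i lt_j|i j k lt_i lt_j lt_k].
  - exact: (rr [` nth_sort_in lt_i]).
  - have /forallP/(_ [` nth_sort_in lt_j])/implyP := rs [` nth_sort_in lt_i].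
    exact.
  - have /forallP/(_ [` nth_sort_in lt_j]) := rt [` nth_sort_in lt_i].
    move=> /forallP/(_ [` nth_sort_in lt_k])/implyP h ij jk.
    by apply: h; rewrite /= -/(ix r i j) -/(ix r j k) ij jk.
case=> r0 sub rr rs rt; split=> //.
- apply/forallP => x; rewrite -ix_pos ?(valP x) //.
  by rewrite rr // pos_lt ?(valP x).
- apply/forallP => x; apply/forallP => y; apply/implyP.
  rewrite -!ix_pos ?(valP x) ?(valP y) //.
  by apply: rs; rewrite pos_lt ?(valP x) ?(valP y).
- apply/forallP => x; apply/forallP => y; apply/forallP => z.
  rewrite -!ix_pos ?(valP x) ?(valP y) ?(valP z) //.
  apply/implyP => /andP[]; apply: rt.
  all: by rewrite pos_lt ?(valP x) ?(valP y) ?(valP z).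
Qed.

(** * Relations on intervals and their restrictions *)

Definition interval_rel (n : nat) (e : rel nat) : relstr :=
  (interval 1 n, [fset x in interval 1 n `*` interval 1 n | e x.1.-1 x.2.-1]).

Lemma mem_interval m n x : (x \in interval m n) = (m <= x <= n).
Proof. by rewrite in_fset /= mem_index_iota ltnS. Qed.

Lemma sort_interval m n : sort leq (interval m n) = index_iota m n.+1.
Proof.
apply: (sorted_eq leq_trans anti_leq); rewrite ?iota_sorted //.
  exact/sort_sorted/leq_total.
rewrite perm_sort; apply: uniq_perm; rewrite ?fset_uniq ?iota_uniq //.
by move=> x; rewrite mem_interval mem_index_iota ltnS.
Qed.

Lemma card_interval m n : #|` interval m n| = n.+1 - m.
Proof. by rewrite -size_sort_fset sort_interval size_iota. Qed.

Lemma nth_interval m n i : i < n.+1 - m ->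
  nth 0 (sort leq (interval m n)) i = m + i.
Proof. by move=> lt_i; rewrite sort_interval nth_iota. Qed.

Lemma len_interval_rel n e : len (interval_rel n e) = n.
Proof. by rewrite /len card_interval subn1. Qed.

Lemma ix_interval_rel n e i j : i < n -> j < n ->
  ix (interval_rel n e) i j = e i j.
Proof.
move=> lt_i lt_j.
rewrite /ix !nth_interval ?subn1 // /related !inE /= !mem_index_iota.
by rewrite !add1n !ltnS lt_i lt_j.
Qed.

Lemma mem_interval_rel n e x y : ((x, y) \in (interval_rel n e).2) =
  [&& x \in interval 1 n, y \in interval 1 n & e x.-1 y.-1].
Proof. by rewrite !inE /= andbA. Qed.

Lemma related_carrier (r : relstr) x y :
  r.2 `<=` carrier r `*` carrier r -> related r x y ->
  x \in carrier r /\ y \in carrier r.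
Proof. by move=> sub_r /(fsubsetP sub_r); rewrite in_fsetM => /andP[]. Qed.

(** A normal form: with [eq_interval_rel], agreement of [ix] below [n] becomes equality, so vertices
    are compared by [=] rather than up to isomorphism. *)
Lemma interval_rel_ix r n : carrier r = interval 1 n ->
  r.2 `<=` carrier r `*` carrier r -> r = interval_rel n (ix r).
Proof.
move=> rX sub_r; rewrite {1}[r]surjective_pairing -/(carrier r) rX.
congr pair; apply/fsetP => -[x y].
rewrite mem_interval_rel.
have ixE : x \in interval 1 n -> y \in interval 1 n ->
    ix r x.-1 y.-1 = ((x, y) \in r.2).
  rewrite !mem_interval /ix rX => /andP[x1 xn] /andP[y1 yn].
  by rewrite !nth_interval ?subn1 ?prednK // !add1n !prednK.
apply/idP/and3P => [rxy|[x_in y_in]]; last by rewrite ixE.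
have [] := related_carrier sub_r rxy; rewrite rX => x_in y_in.
by split; rewrite ?ixE.
Qed.

Lemma fsetI_interval_le m n m' n' : m <= m' -> n' <= n ->
  interval m n `&` interval m' n' = interval m' n'.
Proof.
by move=> le_m le_n; apply/fsetP => x; rewrite in_fsetI !mem_interval; lia.
Qed.

Lemma len_restrict r m n m' n' : carrier r = interval m n ->
  m <= m' -> n' <= n -> len (restrict r (interval m' n')) = n'.+1 - m'.
Proof.
by move=> rX le_m le_n; rewrite /len /= rX fsetI_interval_le ?card_interval.
Qed.

Lemma ix_restrict r m n m' n' i j : carrier r = interval m n ->
    m <= m' -> n' <= n -> i < n'.+1 - m' -> j < n'.+1 - m' ->
  ix (restrict r (interval m' n')) i j = ix r (m' - m + i) (m' - m + j).
Proof.
move=> rX le_m le_n lt_i lt_j.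
rewrite /ix /= rX fsetI_interval_le // !nth_interval; try lia.
rewrite /related in_fsetI in_fsetM /= !mem_interval !addnA !subnKC //.
have [-> ->] : m' + i <= n' /\ m' + j <= n' by lia.
by rewrite !leq_addr !andbT.
Qed.

Lemma is_equivalence_interval_rel n (g : nat -> nat) :
  0 < n -> is_equivalence (interval_rel n (fun i j => g i == g j)).
Proof.
move=> n_gt0; apply/is_equivalenceP; rewrite len_interval_rel; split=> //.
- apply/fsubsetP => -[x y].
  by rewrite mem_interval_rel in_fsetM /= => /and3P[-> ->].
- by move=> i lt_i; rewrite ix_interval_rel.
- by move=> i j lt_i lt_j; rewrite !ix_interval_rel // eq_sym.
- move=> i j k lt_i lt_j lt_k; rewrite !ix_interval_rel //.
  by move=> /eqP-> /eqP->.
Qed.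

Lemma eq_interval_rel n (e f : rel nat) :
  (forall i j, i < n -> j < n -> e i j = f i j) ->
  interval_rel n e = interval_rel n f.
Proof.
move=> ef; congr pair; apply/fsetP => -[x y]; rewrite !mem_interval_rel.
rewrite !mem_interval; apply/and3P/and3P => -[/andP[x1 xn] /andP[y1 yn]].
all: by rewrite ?ef ?prednK // -?ef ?prednK // x1 xn y1 yn; split.
Qed.

(** Lengths strictly decrease along the chain: an embedding between relations of equal length has
    offset zero and can be reversed. *)
Lemma no_descending_chain (d : nat -> relstr) :
  ~ (forall i, embeds (d i.+1) (d i) && ~~ embeds (d i) (d i.+1)).
Proof.
move=> desc; have lt_len i : len (d i.+1) < len (d i).
  have /andP[/embedsP[k le_k kE] /negP nle] := desc i.
  rewrite ltnNge; apply/negP => ge_len; apply: nle.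
  have k0 : k = 0 by lia.
  apply/embedsP; exists 0; first by lia.
  by move=> u w lt_u lt_w; rewrite [RHS]kE ?k0 ?add0n //; lia.
have le_len i : len (d i) + i <= len (d 0).
  by elim: i => [|i IHi]; [rewrite addn0 | have := lt_len i; lia].
by have := le_len (len (d 0)).+1; lia.
Qed.

Lemma card_fset_le1P (K : choiceType) (A : {fset K}) x y :
  #|` A| <= 1 -> x \in A -> y \in A -> x = y.
Proof.
move=> A1 Ax Ay; apply: contraTeq A1 => xy; rewrite -ltnNge.
have <- : #|` [fset x; y]| = 2 by rewrite cardfs2 xy.
by apply/fsubset_leq_card/fsubsetP => z; rewrite !inE => /orP[]/eqP->.
Qed.

Lemma card_fset_gt1_neq (K : choiceType) (A : {fset K}) x :
  1 < #|` A| -> exists2 y, y \in A & y != x.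
Proof.
move=> A2; have : 0 < #|` A `\ x| by move: A2; rewrite (cardfsD1 x); lia.
by rewrite cardfs_gt0 => /fset0Pn[y]; rewrite in_fsetD1 => /andP[]; exists y.
Qed.

(** * Cycles in digraphs *)

Section Cycles.
Variables (T : eqType) (e : rel T).

Lemma cycle_nth_mod x0 c j : c != [::] -> cycle e c ->
  e (nth x0 c (j %% size c)) (nth x0 c (j.+1 %% size c)).
Proof.
case: c => // x s _ cyc; set n := size (x :: s).
have lt_j : j %% n < n by rewrite ltn_pmod.
have := pathP x0 cyc (j %% n); rewrite size_rcons => /(_ lt_j).
rewrite -rcons_cons nth_rcons lt_j.
suff -> : nth x0 (rcons s x) (j %% n) = nth x0 (x :: s) (j.+1 %% n) by [].
rewrite -addn1 -modnDml addn1 nth_rcons.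
have [lt_js|ge_js] := ltnP (j %% n) (size s).
  by rewrite (@modn_small (j %% n).+1).
have -> : j %% n = size s by apply/eqP; rewrite eqn_leq ge_js -ltnS lt_j.
by rewrite eqxx modnn.
Qed.

Lemma cycle_ind_forward (P : T -> Prop) c v : cycle e c -> v \in c ->
  (forall u w, e u w -> P u -> P w) -> P v -> forall u, u \in c -> P u.
Proof.
move=> cyc /rot_to[i s cE] step Pv u.
rewrite -(mem_rot i) cE; move: cyc; rewrite -(rot_cycle i) cE /=.
rewrite rcons_path => /andP[+ _]; rewrite inE => + us.
elim: s v Pv us {cE} => [|w s IHs] v Pv /=; first by rewrite orbF => /eqP->.
rewrite inE => /predU1P[-> //|us] /andP[evw].
by apply: IHs => //; apply: step Pv.
Qed.

Lemma uniq_cycle_through c v : cycle e c -> v \in c ->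
  exists c', [/\ cycle e c', uniq c', v \in c' & {subset c' <= c}].
Proof.
move=> cyc /rot_to[i s cE]; move: cyc; rewrite -(rot_cycle i) cE /=.
rewrite rcons_path => /andP[ps].
case: (shortenP ps) => s' ps' us' sub_s' ev.
exists (v :: s'); split; rewrite ?mem_head //=; first by rewrite rcons_path ps'.
move=> u us; rewrite -(mem_rot i) cE; move: us.
by rewrite !inE => /predU1P[->|/sub_s' ->]; rewrite ?eqxx ?orbT.
Qed.

(** A simple cycle through the in-branching [x] suffices. Without an out-branching vertex no edge
    could leave it, so all of [c], including the out-branching [y], would lie on it. *)
Lemma uniq_in_out_cycle (bin bout : pred T) c :
    (forall u u' w, ~~ bin w -> e u w -> e u' w -> u = u') ->
    (forall u w w', ~~ bout u -> e u w -> e u w' -> w = w') ->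
    cycle e c -> has bin c -> has bout c ->
  exists c', [/\ cycle e c', uniq c', has bin c' & has bout c'].
Proof.
move=> bin1 bout1 cyc /hasP[x xc bx] /hasP[y yc y_bout].
have [c' [cyc' uc' xc' sub_c']] := uniq_cycle_through cyc xc.
exists c'; split=> //; first by apply/hasP; exists x.
apply: contraT => /hasPn nbout.
have sub_c : forall u, u \in c -> u \in c'.
  apply: (cycle_ind_forward cyc xc _ xc') => u w euw c'u.
  have nu := next_cycle cyc' c'u.
  by rewrite (bout1 _ _ _ (nbout u c'u) euw nu) mem_next.
by case/negP: (nbout y (sub_c y yc)).
Qed.

End Cycles.

Lemma cycle_nonincreasing (T : eqType) (e : rel T) (f : T -> nat) c :
    cycle e c -> {in c &, forall u w, e u w -> f w <= f u} ->
  {in c &, forall u w, f w <= f u}.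
Proof.
move=> cyc f_step u w uc wc.
(* The hypothesis covers only edges inside [c], so the relation is cut down to [c] before walking
   around. *)
pose e' := [rel x y | [&& x \in c, y \in c & e x y]].
have cyc' : cycle e' c.
  by apply: (@sub_in_cycle _ (mem c)) cyc => [x y xc yc exy|];
    [rewrite /= xc yc | apply/allP].
apply: (cycle_ind_forward cyc' uc (P := fun w => f w <= f u) _ (leqnn _)) wc.
by move=> x y /and3P[xc yc exy] /(leq_trans _); apply; apply: f_step.
Qed.

Lemma path_map_iota (T : Type) (e : rel T) (W : nat -> T) i k :
  (forall t, i <= t < i + k -> e (W t) (W t.+1)) ->
  path e (W i) (map W (iota i.+1 k)).
Proof.
elim: k i => //= k IHk i We; rewrite We ?IHk //; last by lia.
by move=> t le_t; apply: We; lia.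
Qed.

Lemma cycle_map_iota (T : eqType) (e : rel T) (W : nat -> T) i k :
  (forall t, i <= t <= i + k -> e (W t) (W t.+1)) -> W (i + k).+1 = W i ->
  cycle e (map W (iota i k.+1)).
Proof.
move=> We Wik /=; rewrite -[X in rcons _ X]Wik -addSn -map_rcons -cats1.
rewrite -[[:: _]]/(iota (i.+1 + k) 1) -iotaD addn1 path_map_iota // => t le_t.
by apply: We; lia.
Qed.

(** * Counting classes *)

Section ClassCount.
Implicit Types e : rel nat.

(** A class is counted at its last element, so that removing index 0 affects the count through index
    0 alone. *)
Definition last_of_class e n i :=
  all (fun j => ~~ e i j) (iota i.+1 (n - i.+1)).

Definition class_count e n := count (last_of_class e n) (iota 0 n).

Lemma last_of_classP e n i :
  reflect (forall j, i < j < n -> ~~ e i j) (last_of_class e n i).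
Proof.
apply: (iffP allP) => h j; last by rewrite mem_iota => lt_j; apply: h; lia.
by move=> lt_j; apply: h; rewrite mem_iota; lia.
Qed.

Lemma eq_class_count e f n :
  (forall i j, i < n -> j < n -> e i j = f i j) ->
  class_count e n = class_count f n.
Proof.
move=> ef; apply: eq_in_count => i; rewrite mem_iota add0n => /andP[_ lt_i].
by apply/last_of_classP/last_of_classP => h j lt_j; have := h j lt_j;
  rewrite ef //; lia.
Qed.

Lemma class_count_shift e n : class_count e n.+1 =
  last_of_class e n.+1 0 + class_count (fun i j => e i.+1 j.+1) n.
Proof.
rewrite /class_count /= -[1]addn0 iotaDl count_map; congr (_ + _).
apply: eq_in_count => i _ /=; apply/last_of_classP/last_of_classP => h j lt_j.
  by apply: h; rewrite !add1n; lia.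
by case: j lt_j => // j lt_j; apply: h; lia.
Qed.

(** The new index [n] replaces the last element of the class it joins, so no class is added. *)
Lemma class_count_rcons e n t :
    (forall i j, i <= n -> j <= n -> e i j -> e j i) ->
    (forall i j k, i <= n -> j <= n -> k <= n -> e i j -> e j k -> e i k) ->
  t < n -> e t n -> class_count e n.+1 <= class_count e n.
Proof.
move=> se te lt_t tn.
have ex_t : exists t, (t < n) && e t n by exists t; rewrite lt_t.
have ub_t i : (i < n) && e i n -> i <= n by case/andP=> /ltnW.
(* A maximal [t] is the last element of its class below [n]. *)
case: (ex_maxnP ex_t ub_t) => {lt_t tn ex_t ub_t}t /andP[lt_t tn] t_max.
rewrite /class_count -addn1 iotaD count_cat /= addn0 add0n.
have -> : count (last_of_class e n) (iota 0 n) =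
  count (pred1 t) (iota 0 n) + count (predD1 (last_of_class e n) t) (iota 0 n).
  rewrite -count_predUI [X in _ + X](_ : _ = 0) ?addn0; last first.
    rewrite -[RHS](count_pred0 (iota 0 n)); apply: eq_count => i /=.
    by case: eqP.
  apply: eq_count => i /=; case: eqP => //= -> {i}.
  apply/last_of_classP => j /andP[lt_tj lt_j].
  apply/negP => tj; have jn : e j n.
    by apply: (te j t n) => //; try lia; apply: se => //; lia.
  by have := t_max j; rewrite lt_j jn leqNgt lt_tj => /(_ isT).
rewrite addnC leq_add //.
  rewrite -[count (pred1 t) _]/(count_mem t _) count_uniq_mem ?iota_uniq //.
  by rewrite mem_iota lt_t leq_b1.
rewrite -!size_filter uniq_leq_size ?filter_uniq ?iota_uniq // => i.
rewrite !mem_filter mem_iota add0n => /andP[/last_of_classP h /= lt_i].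
rewrite lt_i andbT; apply/andP; split; last first.
  by apply/last_of_classP => j lt_j; apply: h; lia.
by apply: contraNneq (h n _) => [->//|]; lia.
Qed.

End ClassCount.

(** * Good pairs in sequences *)

Section Unbounded.
Implicit Types P Q : nat -> Prop.

Definition unbounded P := forall n, exists2 m, n <= m & P m.

(** Induction on the number of values: if the top value is not taken unboundedly often, restrict to
    indices beyond its last occurrence. *)
Lemma unbounded_pigeonhole P (f : nat -> nat) k :
    unbounded P -> (forall i, P i -> f i < k) ->
  exists c, unbounded (fun i => P i /\ f i = c).
Proof.
elim: k P => [|k IHk] P unbP lt_f; first by have [m _ /lt_f] := unbP 0.
have [unb|] := classic (unbounded (fun i => P i /\ f i = k)); first by exists k.
case/not_all_ex_not => n no_k.
have [||c unb] := IHk (fun i => P i /\ n <= i).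
- move=> m; have [i le_i Pi] := unbP (maxn n m).
  by exists i; [|split=> //]; lia.
- move=> i [Pi le_i]; rewrite ltn_neqAle -ltnS lt_f // andbT.
  by apply/eqP => fik; case: no_k; exists i.
exists c => m; have [i le_i [[Pi _] fi]] := unb m.
by exists i.
Qed.

Lemma unbounded_min P (f : nat -> nat) : unbounded P ->
  exists i, P i /\ forall j, P j -> f i <= f j.
Proof.
move=> /(_ 0)[m _ Pm]; have [n] := ubnP (f m).
elim: n m Pm => // n IHn m Pm; rewrite ltnS => le_f.
have [min|] := classic (forall j, P j -> f m <= f j); first by exists m.
move=> /not_all_ex_not nmin; case: nmin => j nmin.
have [Pj] := imply_to_and _ _ nmin; move/negP; rewrite -ltnNge => lt_f.
by apply: IHn Pj _; lia.
Qed.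

(** Start from an [i] minimising [g]. If [f] stays below [f i] from then on, it is constant on an
    unbounded set, and a minimum of [g] there starts a good pair. *)
Lemma unbounded_dickson P (f g : nat -> nat) : unbounded P ->
  exists i j, [/\ P i, P j, i < j, f i <= f j & g i <= g j].
Proof.
move=> unbP; have [i [Pi g_min]] := unbounded_min g unbP.
have [[j /andP[lt_ij le_f] Pj]|no_j] :=
    classic (exists2 j, (i < j) && (f i <= f j) & P j).
  by exists i, j; split=> //; apply: g_min.
have unbQ : unbounded (fun j => P j /\ i < j).
  move=> n; have [j le_j Pj] := unbP (maxn n i.+1).
  by exists j; [|split=> //]; lia.
have [|c unbR] := unbounded_pigeonhole (f := f) (k := f i) unbQ.
  move=> j [Pj lt_ij]; rewrite ltnNge; apply/negP => le_f.
  by apply: no_j; exists j; rewrite ?lt_ij.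
have [k [[[Pk _] fk] k_min]] := unbounded_min g unbR.
have [l lt_kl [[Pl il] fl]] := unbR k.+1.
by exists k, l; split; rewrite ?fk ?fl //; apply: k_min.
Qed.

Lemma finite_dickson (F : finType) (h : nat -> F) (f g : nat -> nat) :
  exists i j, [/\ i < j, h i = h j, f i <= f j & g i <= g j].
Proof.
have [||c unb] :=
  @unbounded_pigeonhole (fun _ => True) (fun i => enum_rank (h i)) #|F|.
- by move=> n; exists n.
- by move=> i _; apply: ltn_ord.
have [i [j [[_ hi] [_ hj] lt_ij le_f le_g]]] := unbounded_dickson f g unb.
exists i, j; split=> //; apply/enum_rank_inj/val_inj.
by rewrite /= hi hj.
Qed.

(** The default 0 covers a search that meets no [P]; in [core_exists] it yields a core touching the
    left end. *)
Lemma last_index P N : 0 < N -> exists p,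
  [/\ p < N, p = 0 \/ P p & forall t, p < t < N -> ~ P t].
Proof.
case: N => // N _; elim: N => [|N [p [lt_p Pp p_max]]].
  by exists 0; split=> //; [left | lia].
have [PN|nPN] := classic (P N.+1).
  by exists N.+1; split=> //; [right | lia].
exists p; split=> //; first by lia.
move=> t lt_t; have [->//|tN] := eqVneq t N.+1.
by apply: p_max; lia.
Qed.

(** Here the default is the last index, which yields a core touching the right end. *)
Lemma first_index P p N : p < N -> exists q,
  [/\ p <= q < N, q.+1 = N \/ P q & forall t, p <= t < q -> ~ P t].
Proof.
move=> lt_p; rewrite -(subnKC lt_p); move: (N - p.+1) => k {N lt_p}.
elim: k p => [|k IHk] p.
  by exists p; split=> //; [lia | left; rewrite addn0 | lia].
have [Pp|nPp] := classic (P p); first by exists p; split; [lia | right | lia].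
have [q [le_q Pq q_min]] := IHk p.+1.
exists q; split; [lia | by rewrite -addSnnS|].
move=> t le_t; have [->//|tp] := eqVneq t p.
by apply: q_min; lia.
Qed.

End Unbounded.

(** * The factor graph *)

Section FactorGraphTheory.
Variable B : {fset relstr}.
Hypothesis B_equiv : forall r, r \in B -> is_equivalence r.
Hypothesis B_nonempty : B != fset0.

Notation b := (maxlen B).

Lemma len_le_maxlen r : r \in B -> len r <= b.
Proof. by move=> Br; rewrite /maxlen (big_rem r) //= leq_maxl. Qed.

Lemma maxlen_gt0 : 0 < b.
Proof.
case/fset0Pn: B_nonempty => r Br.
by apply: leq_trans (len_le_maxlen Br); case/is_equivalenceP: (B_equiv Br).
Qed.

Lemma AvP s : reflect (is_equivalence s /\ forall r, r \in B -> ~~ embeds r s)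
  (Av B s).
Proof.
apply: (iffP andP) => [[eq_s /forallP avoid]|[eq_s avoid]]; split=> //.
  by move=> r Br; apply: (avoid [` Br]).
by apply/forallP => r; apply: avoid; apply: valP.
Qed.

Lemma verticesP v : reflect (carrier v = interval 1 b /\ Av B v)
  (v \in vertices B).
Proof.
rewrite /vertices !inE /=.
apply: (iffP andP) => [[/imfsetP[/= g _ ->]]|[vX Avv]].
  by [].
split=> //; apply/imfsetP; exists v.2 => /=; last first.
  by rewrite -vX /carrier -surjective_pairing.
rewrite fpowersetE -vX.
by case/AvP: Avv => /is_equivalenceP[].
Qed.

Lemma vertex_Av v : v \in vertices B -> Av B v.
Proof. by case/verticesP. Qed.

Lemma len_vertex v : v \in vertices B -> len v = b.
Proof. by case/verticesP=> vX _; rewrite /len vX card_interval subn1. Qed.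

Lemma vertexE v : v \in vertices B -> v = interval_rel b (ix v).
Proof.
case/verticesP=> vX /AvP[/is_equivalenceP[_ sub_v _ _ _] _].
exact: interval_rel_ix.
Qed.

(** * Windows, edges and special vertices *)

Definition window (s : relstr) (t : nat) : relstr :=
  interval_rel b (fun i j => ix s (t + i) (t + j)).

Lemma ix_window s t i j : i < b -> j < b ->
  ix (window s t) i j = ix s (t + i) (t + j).
Proof. exact: ix_interval_rel. Qed.

Lemma window_vertex s t : Av B s -> t + b <= len s -> window s t \in vertices B.
Proof.
move=> /AvP[/is_equivalenceP[s0 sub_s rs ss ts] avoid] le_t.
have lt_s i : i < b -> t + i < len s by lia.
apply/verticesP; split=> //; apply/AvP; split.
  apply/is_equivalenceP; rewrite len_interval_rel; split.
  - exact: maxlen_gt0.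
  - apply/fsubsetP => -[x y].
    by rewrite mem_interval_rel in_fsetM /= => /and3P[-> ->].
  - by move=> i lt_i; rewrite ix_window // rs ?lt_s.
  - by move=> i j lt_i lt_j; rewrite !ix_window //; apply: ss; apply: lt_s.
  - move=> i j k lt_i lt_j lt_k; rewrite !ix_window //.
    by apply: ts; apply: lt_s.
move=> r Br; apply: contra (avoid r Br) => /embeds_trans; apply.
apply/embedsP; exists t; rewrite len_interval_rel // => i j lt_i lt_j.
exact: ix_window.
Qed.

(** An occurrence of a forbidden [r] has length at most [b], so it lies inside a window. *)
Lemma Av_windows s : is_equivalence s -> b <= len s ->
  (forall t, t + b <= len s -> window s t \in vertices B) -> Av B s.
Proof.
move=> eq_s le_b ws; apply/AvP; split=> // r Br; apply/negP.
case/embedsP=> k le_k rsE.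
have le_r := len_le_maxlen Br.
(* Near the right end the window is pushed back to start at [len s - b]. *)
have [k' [le_k' k_ge k_le]] :
    exists k', [/\ k' + b <= len s, k' <= k & k + len r <= k' + b].
  by exists (minn k (len s - b)); split; lia.
have /vertex_Av/AvP[_ /(_ r Br)/negP] := ws _ le_k'; apply.
apply/embedsP; exists (k - k'); rewrite ?len_interval_rel; first lia.
move=> i j lt_i lt_j; rewrite rsE // ix_window; try lia.
by congr (ix s _ _); lia.
Qed.

Lemma edgeP u v : reflect [/\ u \in vertices B, v \in vertices B &
    forall i j, i.+1 < b -> j.+1 < b -> ix u i.+1 j.+1 = ix v i j]
  (edge B u v).
Proof.
have b_gt0 := maxlen_gt0.
apply: (iffP and3P) => -[u_in v_in] h; split=> //.
all: have [[uX _] [vX _]] := (verticesP _ u_in, verticesP _ v_in).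
  have [_ uv] := isomorphicP _ _ h => i j lt_i lt_j.
  have [lt_iu lt_ju] : i < b.+1 - 2 /\ j < b.+1 - 2 by lia.
  have := uv i j; rewrite (len_restrict uX) // => /(_ lt_iu lt_ju).
  rewrite (ix_restrict uX) // (ix_restrict vX) ?leq_pred //; lia.
apply/isomorphicP; rewrite (len_restrict uX) // (len_restrict vX) ?leq_pred //.
split=> [|i j lt_i lt_j]; first by lia.
by rewrite (ix_restrict uX) // (ix_restrict vX) ?leq_pred ?h //; lia.
Qed.

Lemma specialP v : v \in vertices B ->
  reflect (forall i, i.+1 < b -> ~~ ix v b.-1 i) (special B v).
Proof.
move=> v_in; have b_gt0 := maxlen_gt0; have [vX] := verticesP _ v_in.
case/AvP=> /is_equivalenceP[_ _ + _ _] _; rewrite (len_vertex v_in) => rv.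
have ixE i j : i < b -> j < b -> ix v i j = related v i.+1 j.+1.
  by move=> lt_i lt_j; rewrite /ix vX !nth_interval ?subn1.
have relbb : related v b b.
  by have := rv b.-1; rewrite ixE prednK //; apply; lia.
rewrite /special; apply: (iffP (cardfs1P _)) => [[x sE] i lt_i|vS].
  have xb : b = x.
    by apply/fset1P; rewrite -sE !inE /= relbb vX mem_interval b_gt0 leqnn.
  apply/negP; rewrite ixE ?prednK ?(ltnW lt_i) // => rel_i.
  have : i.+1 \in [fset x].
    by rewrite -sE !inE /= rel_i vX mem_interval (ltnW lt_i).
  by move=> /fset1P; rewrite -xb => bE; rewrite bE ltnn in lt_i.
exists b; apply/fsetP => y; rewrite !inE /= vX mem_interval.
apply/andP/eqP => [[/andP[y1 yb] rel_y]|->]; last by rewrite b_gt0 leqnn.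
case: y y1 yb rel_y => // y _; rewrite leq_eqVlt => /predU1P[//|lt_y] rel_y.
by case/negP: (vS y lt_y); rewrite ixE ?prednK // ltnW.
Qed.

Lemma not_special_linked v : v \in vertices B -> ~~ special B v ->
  exists2 i, i.+1 < b & ix v b.-1 i.
Proof.
move=> v_in nspe.
have [/hasP[i]|/hasPn new] := boolP (has (ix v b.-1) (iota 0 b.-1)).
  by rewrite mem_iota add0n => /andP[_ lt_i]; exists i => //; lia.
case/negP: nspe; apply/specialP => // i lt_i.
by apply: new; rewrite mem_iota; lia.
Qed.

Lemma in_neighbourE u v :
  (u \in [fset u in vertices B | edge B u v]) = edge B u v.
Proof.
by rewrite in_fset /=; apply/andP/idP => [[]//|uv]; split=> //; case/edgeP: uv.
Qed.

Lemma out_neighbourE u v :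
  (v \in [fset v in vertices B | edge B u v]) = edge B u v.
Proof.
by rewrite in_fset /=; apply/andP/idP => [[]//|uv]; split=> //; case/edgeP: uv.
Qed.

Lemma indegree_le1P u u' v :
  ~~ (1 < indegree B v) -> edge B u v -> edge B u' v -> u = u'.
Proof.
rewrite -leqNgt => v1 uv u'v.
by apply: card_fset_le1P v1 _ _; rewrite in_neighbourE.
Qed.

Lemma outdegree_le1P u v v' :
  ~~ (1 < outdegree B u) -> edge B u v -> edge B u v' -> v = v'.
Proof.
rewrite -leqNgt => u1 uv uv'.
by apply: card_fset_le1P u1 _ _; rewrite out_neighbourE.
Qed.

Lemma indegree_gt1_neq v x : 1 < indegree B v -> exists2 u, edge B u v & u != x.
Proof.
by move=> /(card_fset_gt1_neq x)[u]; rewrite in_neighbourE; exists u.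
Qed.

Lemma outdegree_gt1_neq v x : 1 < outdegree B v ->
  exists2 u, edge B v u & u != x.
Proof.
by move=> /(card_fset_gt1_neq x)[u]; rewrite out_neighbourE; exists u.
Qed.

(** * Labellings of vertices and of walks *)

Lemma vertex_equivalence v : v \in vertices B ->
  [/\ forall i, i < b -> ix v i i,
    forall i j, i < b -> j < b -> ix v i j -> ix v j i
  & forall i j k, i < b -> j < b -> k < b -> ix v i j -> ix v j k -> ix v i k].
Proof.
move=> v_in; have [/is_equivalenceP[_ _]] := AvP _ (vertex_Av v_in).
by rewrite len_vertex.
Qed.

Lemma vertex_labelling v : v \in vertices B ->
  exists g : nat -> nat, forall i j, i < b -> j < b -> ix v i j = (g i == g j).
Proof.
move=> v_in; have [rv sv tv] := vertex_equivalence v_in.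
(* Each index is labelled by the least index related to it. *)
exists (fun i => find (ix v i) (iota 0 b)) => i j lt_i lt_j.
apply/idP/eqP => [ij|eq_ij].
  apply: eq_in_find => k; rewrite mem_iota => /andP[_ lt_k].
  by apply/idP/idP; apply: tv => //; apply: sv.
have has_i : has (ix v i) (iota 0 b).
  by apply/hasP; exists i; rewrite ?mem_iota ?rv.
have has_j : has (ix v j) (iota 0 b).
  by apply/hasP; exists j; rewrite ?mem_iota ?rv.
have := nth_find 0 has_j; rewrite -eq_ij; have := nth_find 0 has_i.
move: has_i; rewrite has_find size_iota => lt_f; rewrite nth_iota // add0n.
by move=> if_ jf; apply: tv if_ _ => //; apply: sv.
Qed.

Lemma next_label u (g : nat -> nat) n : u \in vertices B ->
  (forall i j, i.+1 < b -> j.+1 < b -> ix u i j = (g (n + i) == g (n + j))) ->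
  exists l, (forall i, i.+1 < b -> ix u b.-1 i = (l == g (n + i))) /\
    (special B u -> forall z, z < n + b.-1 -> g z != l).
Proof.
move=> u_in gP; have [ru su tu] := vertex_equivalence u_in.
have lt_last : b.-1 < b by rewrite prednK ?maxlen_gt0.
have [spe|nspe] := boolP (special B u); last first.
  have [k lt_k bk] := not_special_linked u_in nspe.
  exists (g (n + k)); split=> [i lt_i|//].
  have lt_i' := ltnW lt_i; rewrite -gP; try lia.
  by apply/idP/idP; apply: tu => //; try lia; apply: su => //; lia.
(* This exceeds every label used so far. *)
exists (\max_(z < n + b.-1) g z).+1.
have lt_new z : z < n + b.-1 -> g z < (\max_(z < n + b.-1) g z).+1.
  by move=> lt_z; rewrite ltnS (leq_bigmax (Ordinal lt_z)).
split=> [i lt_i|_ z /lt_new]; last by rewrite neq_ltn => ->.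
rewrite (negbTE (specialP u_in spe i lt_i)).
by rewrite gtn_eqF // lt_new //; lia.
Qed.

(** Induction on the walk: window [N.+1] has one new entry, at position [N.+1 + b.-1], and its other
    pairs are read by window [N]. The freshness clause serves [special_walk_relation]. *)
Lemma realize (V : nat -> relstr) N :
    (forall t, t <= N -> V t \in vertices B) ->
    (forall t, t < N -> edge B (V t) (V t.+1)) ->
  exists g : nat -> nat,
    (forall t i j, t <= N -> i < b -> j < b ->
      ix (V t) i j = (g (t + i) == g (t + j))) /\
    (forall t z, t <= N -> special B (V t) -> z < t + b.-1 ->
      g z != g (t + b.-1)).
Proof.
have b_gt0 := maxlen_gt0.
elim: N => [|N IHN] V_in V_edge.
  have [g gP] := vertex_labelling (V_in 0 isT).
  exists g; split=> [t i j|t z]; rewrite leqn0 => /eqP->; first exact: gP.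
  rewrite add0n => /(specialP (V_in 0 isT)) spe lt_z.
  by rewrite eq_sym -gP ?spe //; lia.
have [||g [gP g_new]] := IHN.
- by move=> t le_t; apply: V_in; lia.
- by move=> t lt_t; apply: V_edge; lia.
have [_ u_in shift] := edgeP _ _ (V_edge N (ltnSn N)).
have [|l [lP l_new]] := next_label (g := g) (n := N.+1) u_in.
  move=> i j lt_i lt_j; rewrite -shift // gP // ?addnS ?addSn //.
exists (fun x => if x == N.+1 + b.-1 then l else g x).
have old x : x < N.+1 + b.-1 -> (x == N.+1 + b.-1) = false by lia.
split=> [t i j|t z]; rewrite leq_eqVlt ltnS => /predU1P[->|le_t].
- have [ru su tu] := vertex_equivalence u_in.
  move=> lt_i lt_j; rewrite !eqn_add2l.
  have [->|ni] := eqVneq i b.-1; have [->|nj] := eqVneq j b.-1.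
  + by rewrite eqxx ru //; lia.
  + by rewrite lP //; lia.
  + rewrite eq_sym -lP; last by lia.
    by apply/idP/idP; apply: su; lia.
  + by rewrite -shift ?gP ?addnS ?addSn //; lia.
- by move=> lt_i lt_j; rewrite !old ?gP //; lia.
- by move=> spe lt_z; rewrite eqxx old // l_new.
by move=> spe lt_z; rewrite !old ?g_new //; lia.
Qed.

(** * Antichains from bad cycles *)

Lemma Av_label (g : nat -> nat) (V : nat -> relstr) N :
    (forall t, t <= N -> V t \in vertices B) ->
    (forall t i j, t <= N -> i < b -> j < b ->
      ix (V t) i j = (g (t + i) == g (t + j))) ->
  let r := interval_rel (N + b) (fun i j => g i == g j) in
  Av B r /\ forall t, t <= N -> window r t = V t.
Proof.
move=> V_in gP r.
have rV t : t <= N -> window r t = V t.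
  move=> le_t; rewrite [RHS](vertexE (V_in t le_t)).
  apply: eq_interval_rel => i j lt_i lt_j.
  by rewrite ix_interval_rel ?gP //; lia.
split=> //; have b_gt0 := maxlen_gt0; apply: Av_windows.
- by apply: is_equivalence_interval_rel; lia.
- by rewrite len_interval_rel leq_addl.
- by move=> t; rewrite len_interval_rel leq_add2r => le_t; rewrite rV // V_in.
Qed.

Lemma embeds_window r s : embeds r s -> exists k, [/\ k + len r <= len s,
    forall i j, i < len r -> j < len r -> ix r i j = ix s (k + i) (k + j)
  & forall t, t + b <= len r -> window s (k + t) = window r t].
Proof.
case/embedsP=> k le_k rsE; exists k; split=> // t le_t.
by apply: eq_interval_rel => i j lt_i lt_j; rewrite rsE ?addnA //; lia.
Qed.

Lemma in_out_antichain c : in_out_cycle B c -> exists a : nat -> relstr,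
  (forall i, Av B (a i)) /\ forall i j, i != j -> ~~ embeds (a i) (a j).
Proof.
case/and3P=> /andP[_ cyc] c_in c_out.
(* On a simple cycle, the walk [w] below is injective modulo the cycle length. *)
have [{}c [{}cyc c_uniq {}c_in {}c_out]] :=
  uniq_in_out_cycle indegree_le1P outdegree_le1P cyc c_in c_out.
have [x xc x_in] := hasP c_in; have [y yc y_out] := hasP c_out.
have [i s cE] := rot_to xc.
have {i c cyc c_uniq c_in c_out xc yc cE} [cyc c_uniq yc] :
    [/\ cycle (edge B) (x :: s), uniq (x :: s) & y \in x :: s].
  by rewrite -cE rot_cycle rot_uniq mem_rot.
set c := x :: s in cyc c_uniq yc; pose p := size c.
pose w j := nth x c (j %% p).
have w_edge j : edge B (w j) (w j.+1) by apply: cycle_nth_mod.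
(* At step [K n] the walk stands at [y] after [n] full turns. *)
pose K0 := index y c; pose K n := K0 + n * p.
have lt_K0 : K0 < p by rewrite index_mem.
have wK n : w (K n) = y by rewrite /w /K addnC modnMDl modn_small // nth_index.
(* [a] differs from the predecessor of [x] on the cycle, and [d] from the successor of [y]. *)
have [a ax a_neq] := indegree_gt1_neq (w p.-1) x_in.
have [d yd d_neq] := outdegree_gt1_neq (w K0.+1) y_out.
pose P n t := if t == 0 then a else if t <= (K n).+1 then w t.-1 else d.
have P_edge n t : t < (K n).+2 -> edge B (P n t) (P n t.+1).
  rewrite ltnS /P => le_t /=; have [->|t0] := eqVneq t 0; first exact: ax.
  rewrite le_t; have [lt_t|ge_t] := ltnP.
    by rewrite -{2}(prednK (n := t)) ?lt0n.
  have -> : t = (K n).+1 by lia.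
  by rewrite /= wK.
have P_in n t : t <= (K n).+2 -> P n t \in vertices B.
  rewrite leq_eqVlt => /predU1P[->|lt_t].
    by have /edgeP[] := P_edge n (K n).+1 (ltnSn _).
  by have /edgeP[] := P_edge n t lt_t.
have ex_r n : exists r, [/\ Av B r, len r = (K n).+2 + b &
    forall t, t <= (K n).+2 -> window r t = P n t].
  have [g [gP _]] := realize (P_in n) (P_edge n).
  have [Avr rP] := Av_label (P_in n) gP.
  by eexists; split; [exact: Avr | exact: len_interval_rel | exact: rP].
have [r rP] := functional_choice _ ex_r.
exists r; split=> [n|m n mn]; first by case: (rP n).
have [_ len_m mP] := rP m; have [_ len_n nP] := rP n.
apply/negP => /embeds_window[k []]; rewrite len_m len_n => le_k _ emb.
have p_gt0 : 0 < p by [].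
have lt_mn : m < n.
  rewrite ltn_neqAle mn -(leq_pmul2r p_gt0).
  by rewrite /K in le_k; lia.
have lt_K : K m < K n by rewrite /K ltn_add2l ltn_pmul2r.
have PE t : t <= (K m).+2 -> P n (k + t) = P m t.
  by move=> le_t; rewrite -nP ?emb ?mP //; lia.
have w_inj i j : w i = w j -> i = j %[mod p].
  by move/eqP; rewrite nth_uniq ?ltn_pmod // => /eqP.
(* At a positive offset, the initial [a] would match a vertex of the longer walk that is on the
   cycle and followed by [x], that is, the predecessor of [x] there. *)
have k0 : k = 0.
  apply/eqP; apply: contraTT a_neq; rewrite -lt0n negbK => k_gt0.
  have -> : a = w k.-1.
    rewrite -[a]/(P m 0) -PE // addn0 /P -[k == 0]negbK -lt0n k_gt0.
    by have -> : k <= (K n).+1 by lia.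
  have : w k = w 0.
    rewrite -[w 0]/(P m 1) -PE // addn1 /P /=.
    by have -> : k < (K n).+1 by lia.
  move/w_inj; rewrite mod0n => /eqP /dvdnP[q kE].
  have q_gt0 : 0 < q by rewrite kE muln_gt0 in k_gt0; case/andP: k_gt0.
  have -> : k.-1 = q.-1 * p + p.-1 by rewrite kE -{1}(prednK q_gt0) mulSn; lia.
  by rewrite /w modnMDl modn_small // prednK.
(* The exit to [d] in the shorter walk meets the longer one still on the cycle, at the successor of
   [y]. *)
have := PE (K m).+2 (leqnn _); rewrite k0 add0n /P ltnn /= ltnS lt_K => dE.
case/eqP: d_neq; rewrite -dE /w.
by rewrite /K -addSn addnC modnMDl.
Qed.

(* V returns to its special vertex every p steps.  The entry created there has a
   fresh label, so b visits give b distinct labels; the b - 1 entries before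
   a later visit miss one of them, which can be reused as the new label. *)
Lemma special_walk_relation (V : nat -> relstr) p n :
    0 < p -> (forall t, edge B (V t) (V t.+1)) ->
    (forall i, V (i * p) = V 0) -> special B (V 0) ->
  exists r d, [/\ Av B r, len r = d + b, n * (b * p) < d <= n.+1 * (b * p),
    [/\ special B (window r 0), special B (window r d) & ix r b.-1 (d + b.-1)]
  & forall x y, x < y <= d ->
      special B (window r x) -> special B (window r y) ->
      ix r (x + b.-1) (y + b.-1) -> x = 0 /\ y = d].
Proof.
move=> p_gt0 V_edge V_per V_special; have b_gt0 := maxlen_gt0.
have lt_last : b.-1 < b by rewrite prednK.
have V_in t : V t \in vertices B by case/edgeP: (V_edge t).
(* [M] is the closing visit. The opening visit [i] is among the first [b], which puts their distance
   in the range prescribed for [n]. *)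
pose M := n.+1 * b.
have [g [gP g_new]] :=
  realize (N := M * p) (fun t _ => V_in t) (fun t _ => V_edge t).
have le_bM : b <= M by rewrite /M mulSn leq_addr.
have [i lt_i i_new] : exists2 i, i < b &
    forall z, z < b.-1 -> g (M * p + z) != g (i * p + b.-1).
  pose s1 := [seq g (i * p + b.-1) | i <- iota 0 b].
  pose s2 := [seq g (M * p + z) | z <- iota 0 b.-1].
  have [/allP sub|/allPn[_ /mapP[i + ->] i_new]] := boolP (all (mem s2) s1).
    have s1_uniq : uniq s1.
      rewrite map_inj_in_uniq ?iota_uniq // => j k.
      rewrite !mem_iota !add0n /= => lt_j lt_k eq_jk.
      wlog lt_jk : j k lt_j lt_k eq_jk / j < k => [th|].
        have [lt_jk|lt_kj|//] := ltngtP j k; first exact: th.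
        by apply/esym/th.
      have /eqP[] // : g (j * p + b.-1) != g (k * p + b.-1).
      apply: g_new; rewrite ?V_per //.
        by rewrite leq_pmul2r //; lia.
      by rewrite ltn_add2r ltn_pmul2r.
    by have := uniq_leq_size s1_uniq sub; rewrite !size_map !size_iota; lia.
  rewrite mem_iota add0n => lt_i; exists i => // z lt_z.
  apply: contraNneq i_new => <-; apply/mapP; exists z => //.
  by rewrite mem_iota.
have lt_iM : i < M by lia.
have lt_iMp : i * p < M * p by rewrite ltn_pmul2r.
(* Only the last entry is relabelled, with the label created at visit [i]; [i_new] keeps the final
   window equal to [V 0]. *)
pose h x := if x == M * p + b.-1 then g (i * p + b.-1) else g x.
have h_old x : x < M * p + b.-1 -> h x = g x by rewrite /h => /ltn_eqF->.
have hP t j k : t <= M * p -> j < b -> k < b ->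
    ix (V t) j k = (h (t + j) == h (t + k)).
  rewrite leq_eqVlt => /predU1P[->|lt_t] lt_j lt_k; last first.
    by rewrite gP ?h_old //; lia.
  have [rv sv _] := vertex_equivalence (V_in 0).
  have spe := specialP (V_in 0) V_special.
  rewrite V_per /h !eqn_add2l.
  have [->|nj] := eqVneq j b.-1; have [->|nk] := eqVneq k b.-1.
  + by rewrite eqxx rv.
  + rewrite (negbTE (spe _ _)); last by lia.
    by rewrite eq_sym (negbTE (i_new _ _)) //; lia.
  + rewrite (negbTE (i_new _ _)); last by lia.
    have lt_j1 : j.+1 < b by lia.
    by apply: contraNF (spe j lt_j1); apply: sv.
  + by rewrite -(V_per M) gP.
(* The relation starts at visit [i], so the reused label is created at the end of its first
   window. *)
pose d := M * p - i * p.
have iE t : t <= d -> i * p + t <= M * p by lia.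
have h_shift t j k : t <= d -> j < b -> k < b -> ix (V (i * p + t)) j k =
    (h (i * p + (t + j)) == h (i * p + (t + k))).
  by move=> le_t; rewrite !addnA; apply: hP (iE t le_t).
have [Avr rP] := Av_label (g := fun x => h (i * p + x))
  (fun t _ => V_in (i * p + t)) h_shift.
set r := interval_rel _ _ in Avr rP.
exists r, d; split=> //.
- by rewrite len_interval_rel.
- have le_ib : i * p < b * p by rewrite ltn_pmul2r.
  by rewrite /d /M mulSn mulnDl !mulnA; lia.
- rewrite !rP // addn0 V_per; split=> //.
    by rewrite /d subnKC ?V_per // ltnW.
  rewrite ix_interval_rel; try lia.
  have -> : i * p + (d + b.-1) = M * p + b.-1 by lia.
  by rewrite {2}/h eqxx h_old //; lia.
move=> x y /andP[lt_xy le_y]; rewrite !rP //; last by lia.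
move=> spe_x spe_y; rewrite ix_interval_rel; try lia.
have lt_x : i * p + (x + b.-1) < M * p + b.-1 by lia.
rewrite (h_old _ lt_x).
(* Before the closing window, the entry created at [y] is fresh and matches nothing earlier. At
   [y = d] the entry of [x] must carry the label of visit [i], and freshness at [x] leaves only
   [x = 0]. *)
have [yd|nyd] := eqVneq y d; last first.
  rewrite h_old; last by lia.
  by rewrite [i * p + (y + _)]addnA (negbTE (g_new _ _ _ spe_y _)) //; lia.
have -> : i * p + (y + b.-1) = M * p + b.-1 by lia.
rewrite /h eqxx; have [->//|x0] := eqVneq x 0.
by rewrite eq_sym addnA (negbTE (g_new _ _ _ spe_x _)) //; lia.
Qed.

Lemma special_antichain c v : graph_cycle B c -> v \in c -> special B v ->
  exists a : nat -> relstr,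
    (forall i, Av B (a i)) /\ forall i j, i != j -> ~~ embeds (a i) (a j).
Proof.
case/andP=> _ cyc vc spe_v; have [i s cE] := rot_to vc.
rewrite -(rot_cycle i) cE in cyc; set c' := v :: s in cyc.
pose p := size c'; pose V t := nth v c' (t %% p).
have V_edge t : edge B (V t) (V t.+1) by apply: cycle_nth_mod.
have V_per j : V (j * p) = V 0 by rewrite /V modnMl mod0n.
have V0 : special B (V 0) by rewrite /V mod0n.
have ex_r n := special_walk_relation n (ltn0Sn (size s)) V_edge V_per V0.
have [r rP] := functional_choice _ ex_r.
exists r; split=> [n|m n mn]; first by have [d []] := rP n.
have [d [_ len_m dm [m0 md m_ends] _]] := rP m.
have [e [_ len_n en _ nP]] := rP n.
apply/negP => /embeds_window[k []].
rewrite len_m len_n => le_k emb wE; have b_gt0 := maxlen_gt0.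
have bp_gt0 : 0 < b * (size s).+1 by rewrite muln_gt0 b_gt0.
have d_gt0 : 0 < d by case/andP: dm => /(leq_ltn_trans _)->.
(* The two ends of a copy of [r m] are related entries created at special windows of [r n], hence
   the two ends of [r n]. *)
have de : d = e.
  clear - d_gt0 le_k emb wE len_m m0 md m_ends nP b_gt0.
  have [||||k0 kd] := nP k (k + d); try lia.
  - by rewrite -[k]addn0 wE //; lia.
  - by rewrite wE // len_m.
  - by rewrite -!addnA -emb //; lia.
(* The length ranges prescribed for distinct [m] and [n] are disjoint. *)
rewrite de in dm; case/andP: dm => lt_m le_m; case/andP: en => lt_n le_n.
have := leq_trans lt_m le_n; have := leq_trans lt_n le_m.
rewrite !ltn_pmul2r // !ltnS => nm mn'.
by case/eqP: mn; apply/eqP; rewrite eqn_leq mn' nm.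
Qed.

(** * Rigidity along good cycles *)

(** The first entry of [u] leaves, ending its class if it is alone there, and the entry that arrives
    joins an existing class because [w] is not special. *)
Lemma class_count_edge u w : edge B u w -> ~~ special B w ->
  last_of_class (ix u) b 0 + class_count (ix w) b <= class_count (ix u) b.
Proof.
case/edgeP=> u_in w_in uw nspe; have [_ sw tw] := vertex_equivalence w_in.
have b_gt0 := maxlen_gt0.
have [i lt_i bi] := not_special_linked w_in nspe.
have le_w : class_count (ix w) b <= class_count (ix w) b.-1.
  rewrite -{1}(prednK b_gt0); apply: (@class_count_rcons _ _ i).
  - by move=> j k le_j le_k; apply: sw; lia.
  - by move=> j k l le_j le_k le_l; apply: tw; lia.
  - by lia.
  - by apply: sw => //; lia.
rewrite -[X in class_count (ix u) X](prednK b_gt0) class_count_shift prednK //.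
rewrite leq_add2l; apply: leq_trans le_w _.
by rewrite (eq_class_count (f := ix w)) // => j k lt_j lt_k; apply: uw; lia.
Qed.

Section NoInOutNoSpecial.
Hypothesis no_in_out : ~ exists c, in_out_cycle B c.
Hypothesis no_special :
  ~ exists c, graph_cycle B c /\ exists2 v, v \in c & special B v.

Lemma not_special c v : graph_cycle B c -> v \in c -> ~~ special B v.
Proof.
move=> gc vc; apply/negP => spe; apply: no_special.
by exists c; split=> //; exists v.
Qed.

(* Along a cycle without special vertices the number of classes met by the
   window never increases, hence is constant, so no class can die out. *)
Lemma cycle_first_linked c v : graph_cycle B c -> v \in c ->
  exists2 i, 0 < i < b & ix v 0 i.
Proof.
move=> gc vc; have /andP[_ cyc] := gc.
have step : {in c &, forall u w, edge B u w ->
    class_count (ix w) b <= class_count (ix u) b}.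
  move=> u w uc wc uw.
  exact: leq_trans (leq_addl _ _) (class_count_edge uw (not_special gc wc)).
have nvc : next c v \in c by rewrite mem_next.
have := class_count_edge (next_cycle cyc vc) (not_special gc nvc).
have := cycle_nonincreasing cyc step nvc vc.
case: (boolP (last_of_class _ _ _)) => [_|/allPn[i]]; first by lia.
rewrite mem_iota negbK => lt_i vi _ _; exists i => //.
by have := maxlen_gt0; lia.
Qed.

Definition left_rigid v := exists c,
  [/\ graph_cycle B c, v \in c & forall u, u \in c -> ~~ (1 < indegree B u)].

Definition right_rigid v := exists c,
  [/\ graph_cycle B c, v \in c & forall u, u \in c -> ~~ (1 < outdegree B u)].

Lemma cycle_rigid c v : graph_cycle B c -> v \in c ->
  left_rigid v \/ right_rigid v.
Proof.
move=> gc vc.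
have [/hasPn c_in|] := boolP (~~ has (fun u => 1 < indegree B u) c).
  by left; exists c.
rewrite negbK => c_in.
have [/hasPn c_out|] := boolP (~~ has (fun u => 1 < outdegree B u) c).
  by right; exists c.
rewrite negbK => c_out.
by case: no_in_out; exists c; apply/and3P.
Qed.

(** The only predecessor of [w] is the one on its cycle. The link of the first entry of [u] ties the
    entry gained on the left to known ones, as [agree_add] requires. *)
Lemma left_rigid_step u w : left_rigid w -> edge B u w ->
  [/\ left_rigid u, exists2 i, 0 < i < b & ix u 0 i
  & forall u', edge B u' w -> u' = u].
Proof.
case=> c [gc wc c_in] uw; have /andP[_ cyc] := gc.
have uE : u = prev c w
  by apply: indegree_le1P (c_in w wc) uw (prev_cycle cyc wc).
have uc : u \in c by rewrite uE mem_prev.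
split; [by exists c | exact: cycle_first_linked gc uc |].
by move=> u' u'w; apply: indegree_le1P (c_in w wc) u'w uw.
Qed.

(** The mirror image; the last entry of [w] is linked because [w] lies on a cycle and so is not
    special. *)
Lemma right_rigid_step u w : right_rigid u -> edge B u w ->
  [/\ right_rigid w, exists2 i, i.+1 < b & ix w b.-1 i
  & forall w', edge B u w' -> w' = w].
Proof.
case=> c [gc uc c_out] uw; have /andP[_ cyc] := gc.
have wE : w = next c u
  by apply: outdegree_le1P (c_out u uc) uw (next_cycle cyc uc).
have wc : w \in c by rewrite wE mem_next.
have [_ w_in _] := edgeP _ _ uw.
split; [by exists c | exact: not_special_linked w_in (not_special gc wc) |].
by move=> w' uw'; apply: outdegree_le1P (c_out u uc) uw' uw.
Qed.

(** * Extending an agreement between two relations *)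

Lemma window_edge s t : Av B s -> t.+1 + b <= len s ->
  edge B (window s t) (window s t.+1).
Proof.
move=> Avs le_t; apply/edgeP; split; try (apply: window_vertex => //; lia).
by move=> i j lt_i lt_j; rewrite !ix_window ?addSnnS //; lia.
Qed.

(** By transitivity, being related to [a] means being related to [a'], in both relations, so this
    single link settles every pair involving [a]. *)
Lemma agree_add r s d (P : pred nat) a a' :
    is_equivalence r -> is_equivalence s ->
    (forall i, P i || (i == a) -> i < len r /\ d + i < len s) -> P a' ->
    ix r a a' -> ix s (d + a) (d + a') ->
    (forall i j, P i -> P j -> ix r i j = ix s (d + i) (d + j)) ->
  forall i j, P i || (i == a) -> P j || (j == a) ->
    ix r i j = ix s (d + i) (d + j).
Proof.
move=> /is_equivalenceP[_ _ rr sr tr] /is_equivalenceP[_ _ rs ss ts].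
move=> bnd Pa' raa' saa' agr.
have [lt_ar lt_as] : a < len r /\ d + a < len s.
  by apply: bnd; rewrite eqxx orbT.
have bndP j : P j -> j < len r /\ d + j < len s.
  by move=> Pj; apply: bnd; rewrite Pj.
have [lt_a'r lt_a's] := bndP a' Pa'.
have agr_a j : P j -> ix r a j = ix s (d + a) (d + j).
  move=> Pj; have [lt_jr lt_js] := bndP j Pj.
  have -> : ix r a j = ix r a' j.
    by apply/idP/idP; apply: tr => //; apply: sr.
  rewrite agr //; apply/idP/idP; apply: ts => //.
  exact: ss.
move=> i j; have [->|ni] := eqVneq i a; have [->|nj] := eqVneq j a.
all: rewrite ?orbF.
- by rewrite rr // rs.
- by move=> _; apply: agr_a.
- move=> Pi _; have [lt_ir lt_is] := bndP i Pi.
  have -> : ix r i a = ix r a i by apply/idP/idP; apply: sr.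
  by rewrite agr_a //; apply/idP/idP; apply: ss.
- exact: agr.
Qed.

Definition agree r s d x y := forall i j, x <= i < y -> x <= j < y ->
  ix r i j = ix s (d + i) (d + j).

Lemma agree_window r s d x y t : agree r s d x y -> x <= t -> t + b <= y ->
  window s (d + t) = window r t.
Proof.
move=> agr le_x le_y; apply: eq_interval_rel => i j lt_i lt_j.
by rewrite agr ?addnA //; lia.
Qed.

(** Induction on [x]: one step to the left, the windows of [r] and [s] precede the same vertex,
    hence coincide, and their linked first entry lets [agree_add] absorb that position. *)
Lemma agree_extend_left r s d x y : Av B r -> Av B s ->
    x + b <= y -> y <= len r -> d + y <= len s -> left_rigid (window r x) ->
  agree r s d x y -> agree r s d 0 y.
Proof.
move=> Avr Avs; have [eq_r _] := AvP _ Avr; have [eq_s _] := AvP _ Avs.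
have b_gt0 := maxlen_gt0.
elim: x => // x IHx le_xy le_yr le_ys rig agr.
have edge_r : edge B (window r x) (window r x.+1)
  by apply: window_edge => //; lia.
have edge_s : edge B (window s (d + x)) (window r x.+1).
  have <- : window s (d + x.+1) = window r x.+1 by apply: agree_window agr _ _.
  by rewrite addnS; apply: window_edge => //; lia.
have [rig' [i lt_i x_i] uniq_x] := left_rigid_step rig edge_r.
have sr : window s (d + x) = window r x by apply: uniq_x.
apply: IHx => //; first by lia.
have ri : ix r x (x + i) by move: x_i; rewrite ix_window ?addn0 //; lia.
have si : ix s (d + x) (d + (x + i)).
  by move: x_i; rewrite -sr ix_window ?addn0 ?addnA //; lia.
have bnd j : (x < j < y) || (j == x) -> j < len r /\ d + j < len s.
  by clear - le_xy le_yr le_ys b_gt0; lia.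
have xi_in : x < x + i < y by clear - lt_i le_xy; lia.
have inE_x j : x <= j < y -> (x < j < y) || (j == x) by clear; lia.
move=> j k /inE_x j_in /inE_x k_in.
exact: (agree_add (P := fun j => x < j < y) eq_r eq_s bnd xi_in ri si agr).
Qed.

Lemma agree_extend_right r s d x q : Av B r -> Av B s ->
    x <= q -> q + b <= len r -> d + len r <= len s ->
    right_rigid (window r q) ->
  agree r s d x (q + b) -> agree r s d x (len r).
Proof.
move=> Avr Avs; have [eq_r _] := AvP _ Avr; have [eq_s _] := AvP _ Avs.
have b_gt0 := maxlen_gt0.
(* Induction on the number of entries of [r] to the right of window [q]. *)
move: {2}(len r - (q + b)) (erefl (len r - (q + b))) => k.
elim: k q => [|k IHk] q kE le_xq le_q le_s rig agr.
  by have <- : q + b = len r by lia.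
have edge_r : edge B (window r q) (window r q.+1)
  by apply: window_edge => //; lia.
have edge_s : edge B (window r q) (window s (d + q.+1)).
  have <- : window s (d + q) = window r q by apply: agree_window agr _ _.
  by rewrite addnS; apply: window_edge => //; lia.
have [rig' [i lt_i q_i] uniq_q] := right_rigid_step rig edge_r.
have sr : window s (d + q.+1) = window r q.+1 by apply: uniq_q.
apply: (IHk q.+1) => //; try lia.
have ri : ix r (q + b) (q.+1 + i).
  have -> : q + b = q.+1 + b.-1 by lia.
  by move: q_i; rewrite ix_window //; lia.
have si : ix s (d + (q + b)) (d + (q.+1 + i)).
  have -> : q + b = q.+1 + b.-1 by lia.
  by move: q_i; rewrite -sr ix_window ?addnA //; lia.
have bnd j : (x <= j < q + b) || (j == q + b) -> j < len r /\ d + j < len s.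
  by clear - kE le_s b_gt0; lia.
have qi_in : x <= q.+1 + i < q + b by clear - lt_i le_xq; lia.
have inE_q j : x <= j < q.+1 + b -> (x <= j < q + b) || (j == q + b)
  by clear; lia.
move=> j l /inE_q j_in /inE_q l_in.
exact: (agree_add (P := fun j => x <= j < q + b) eq_r eq_s bnd qi_in ri si agr).
Qed.

(** * Cores of bounded length *)

Lemma acyclic_stretch r lo hi : Av B r -> hi + b <= len r ->
    (forall t, lo <= t < hi ->
      ~ exists2 c, graph_cycle B c & window r t \in c) ->
  hi - lo <= #|` vertices B|.
Proof.
move=> Avr le_hi acyc.
pose W := map (window r) (iota lo (hi - lo)).
have <- : size W = hi - lo by rewrite size_map size_iota.
apply: uniq_leq_size.
  rewrite map_inj_in_uniq ?iota_uniq // => i j.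
  rewrite !mem_iota => lt_i lt_j eq_ij.
  wlog lt_ij : i j lt_i lt_j eq_ij / i < j => [th|].
    have [lt_ij|lt_ji|//] := ltngtP i j; first exact: th.
    by apply/esym/th.
  (* A vertex repeated at [i < j] closes a cycle through the window at [i]. *)
  case: (acyc i); first by lia.
  exists (map (window r) (iota i (j - i.+1).+1)); last by rewrite /= mem_head.
  apply/andP; split=> //; apply: cycle_map_iota; last first.
    by have -> : (i + (j - i.+1)).+1 = j by lia.
  by move=> t le_t; apply: window_edge => //; lia.
move=> v /mapP[t]; rewrite mem_iota => lt_t ->.
by apply: window_vertex => //; lia.
Qed.

(** The core occupies the positions from [x] to [y - 1]. Each of its ends is an end of [r] or
    carries a rigid window, from which an agreement spreads outwards. *)
Definition is_core r x y :=
  [/\ x <= y <= len r, y - x <= (#|` vertices B| + b).+1,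
    x = 0 \/ x + b <= y /\ left_rigid (window r x)
  & y = len r \/ exists q, [/\ x <= q, y = q + b & right_rigid (window r q)]].

(** Take the last left-rigid window and the first right-rigid one from there on, or the defaults.
    The windows strictly between are neither, so they lie on no cycle and [acyclic_stretch] bounds
    their number. *)
Lemma core_exists r : Av B r -> exists xy, is_core r xy.1 xy.2.
Proof.
move=> Avr; have [lt_b|le_b] := ltnP (len r) b.
  by exists (0, len r); split=> /=; [lia | lia | left | left].
(* [N] is the number of windows of [r]. *)
have [N NE] : exists N, N = (len r - b).+1 by exists (len r - b).+1.
have N_gt0 : 0 < N by rewrite NE.
have [p [lt_p rig_p p_max]] :=
  last_index (fun t => left_rigid (window r t)) N_gt0.
have [q [le_q rig_q q_min]] :=
  first_index (fun t => right_rigid (window r t)) lt_p.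
exists (p, q + b); rewrite -[is_core _ _ _]/(is_core r p (q + b)).
have : q - p.+1 <= #|` vertices B|.
  apply: (acyclic_stretch (r := r)) => //; first by lia.
  move=> t lt_t [c gc tc].
  by case: (cycle_rigid gc tc) => [/p_max|/q_min]; apply; lia.
move=> le_V; split; [lia | lia | |].
  by case: rig_p => [|rig]; [left | right; split=> //; lia].
case: rig_q => [qN|rig]; first by left; lia.
by right; exists q; split=> //; lia.
Qed.

Lemma Av_good_pair (a : nat -> relstr) : (forall i, Av B (a i)) ->
  exists i j, i != j /\ embeds (a i) (a j).
Proof.
move=> Ava; pose M := (#|` vertices B| + b).+1.
have [x [y xyP]] : exists x y : nat -> nat, forall i, is_core (a i) (x i) (y i).
  have [xy xyP] := functional_choice _ (fun i => core_exists (Ava i)).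
  by exists (fun i => (xy i).1), (fun i => (xy i).2).
(* A table of fixed side [M], at least the core length, keeps the codes in one finite type. *)
pose code i : 'I_M.+1 * {ffun 'I_M * 'I_M -> bool} :=
  (inord (y i - x i),
   [ffun p : 'I_M * 'I_M => ix (a i) (x i + p.1) (x i + p.2)]).
(* Equal codes give isomorphic cores; the inequalities give [a j] enough room on the left and on the
   right of its core. *)
have [i [j [lt_ij [eq_m /ffunP eq_e] le_x le_l]]] :=
  finite_dickson code x (fun i => len (a i) - y i).
exists i, j; split; first by rewrite ltn_eqF.
have [le_i le_Mi left_i right_i] := xyP i; have [le_j le_Mj _ _] := xyP j.
have {}eq_m : y i - x i = y j - x j.
  by have := congr1 val eq_m; rewrite /= !inordK ?ltnS.
(* This offset aligns the two cores. *)
pose d := x j - x i.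
have agr : agree (a i) (a j) d (x i) (y i).
  move=> k l lt_k lt_l.
  have lt_kM : k - x i < M by rewrite /M; lia.
  have lt_lM : l - x i < M by rewrite /M; lia.
  have := eq_e (Ordinal lt_kM, Ordinal lt_lM).
  rewrite !ffunE /= !subnKC; try lia.
  by move->; congr ix; rewrite /d; lia.
have agr_l : agree (a i) (a j) d 0 (y i).
  case: left_i => [xi0|[le_xb rig]]; first by rewrite -xi0.
  by apply: agree_extend_left rig agr => //; rewrite /d; lia.
apply/embedsP; exists d; first by rewrite /d; lia.
suff agr_r : agree (a i) (a j) d 0 (len (a i)).
  by move=> k l lt_k lt_l; apply: agr_r.
case: right_i => [<- //|[q [le_q yE rig]]].
apply: agree_extend_right rig _ => //; try (rewrite /d; lia).
by rewrite -yE.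
Qed.

End NoInOutNoSpecial.
End FactorGraphTheory.

Theorem theorem9p3 (B : {fset relstr})
    (B_equiv : forall r : relstr, r \in B -> is_equivalence r)
    (B_nonempty : B != fset0) :
  wqo embeds (Av B) <->
  ~ (exists c : seq relstr, in_out_cycle B c) /\
  ~ (exists c : seq relstr, graph_cycle B c /\
       exists2 v : relstr, v \in c & special B v).
Proof.
split=> [[no_antichain _]|[no_in_out no_special]].
  split=> [[c c_in_out]|[c [gc [v vc v_special]]]]; apply: no_antichain.
    exact: in_out_antichain c_in_out.
  exact: special_antichain gc vc v_special.
split=> [[a [Ava incomp]]|[d [_ desc]]]; last first.
  exact: (no_descending_chain desc).
have [i [j [ij aij]]] :=
  Av_good_pair B_equiv B_nonempty no_in_out no_special Ava.
by case/negP: (incomp i j ij).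
Qed.
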